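(* Consider the port-Hamiltonian DAE $E\dot x=(J-R)x+Bu(t)$ obtained by modified nodal analysis (MNA) of a linear RLC-network with independent current and voltage sources, i.e. $$E=\begin{pmatrix} A_CCA_C^\top&0&0\\ 0&L&0\\ 0&0&0\end{pmatrix},\quad J=\begin{pmatrix} 0&-A_L&-A_V\\ A_L^\top&0&0\\ A_V^\top&0&0\end{pmatrix},\quad R=\begin{pmatrix} A_GGA_G^\top&0&0\\ 0&0&0\\ 0&0&0\end{pmatrix},\quad B=\begin{pmatrix} -A_I&0\\ 0&0\\ 0&-I\end{pmatrix},$$ and suppose that this DAE has index 1. Let $K_E=\mathrm{blkdiag}(K_C,0,I)$, where $K_C$ is a projector onto $\ker(A_C^\top)$; thus $K_E$ is a projector onto $\ker(E)$. Then: 1. The JR-decomposition of version (a) is not applicable, i.e. it is not the case that both $K_E^\top R=0$ and $K_E^\top B=0$ hold ($R$ and $B$ contribute only to the differential part). 2. If the network contains at least one voltage source, then neither version is applicable, i.e. neither (a) [$K_E^\top R=0$ and $K_E^\top B=0$] nor (b) [$K_E^\top J=0$, meaning that $J$ contributes only to the differential part] holds.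
   Context: Network: a connected network with one grounded node, consisting of capacitances, inductances, resistances, independent current sources and independent voltage sources. $A=[A_C,A_L,A_G,A_I,A_V]$ is the reduced incidence matrix (row of the ground node deleted; one row for each non-ground node, one column for each branch), partitioned according to the element types: capacitances, inductances, resistances, current sources, voltage sources. $C,L,G$ are the constant symmetric positive definite capacitance, inductance and conductance matrices. The state is $x=(e,\imath_L,\imath_V)$ (node potentials, inductor currents, voltage source currents) and the input is $u=(\imath_S,v_S)$ (current and voltage source functions). If an element type does not occur, the corresponding blocks are absent. Index: the index of the constant-coefficient DAE is the Kronecker index of the regular matrix pencil $\lambda E-(J-R)$. For these MNA systems: the index is $0$ (an ODE) if $A_C^\top$ has full column rank and there are no voltage sources; otherwise it is $1$ if there is neither a loop of capacitors and voltage sources with at least one voltage source, nor a cutset consisting only of inductors and/or current sources; otherwise it is $2$. JR-decomposition: the splitting of the right-hand side into $f_1=Jx$ and $f_2=-Rx+Bu$. For index-1 systems it is used in one of two versions: (a) $R$ and $B$ contribute only to the differential part; (b) $J$ contributes only to the differential part. A matrix $M$ ''contributes only to the differential part'' if it does not contribute to the algebraic equations of the DAE, which are obtained by multiplying the DAE from the left by $K_E^\top$; that is, $K_E^\top M=0$. *)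

(* Defs.v *)
From HB Require Import structures.
From mathcomp Require Import all_boot all_order all_algebra.
From mathcomp Require Import reals.

Set Implicit Arguments.
Unset Strict Implicit.
Unset Printing Implicit Defensive.

Import Order.TTheory GRing.Theory Num.Theory.
Local Open Scope ring_scope.

Definition spd_mx (K : realType) (n : nat) (M : 'M[K]_n) : Prop :=
  M^T = M /\ forall v : 'cV[K]_n, v != 0 -> 0 < (v^T *m M *m v) 0 0.

(* The image and the kernel are those of the action on column vectors. *)
Definition projector_onto_ker (K : realType) (n m : nat)
    (P : 'M[K]_n) (M : 'M[K]_(m, n)) : Prop :=
  P *m P = P /\
  forall v : 'cV[K]_n, (exists w : 'cV[K]_n, v = P *m w) <-> M *m v = 0.

Definition regular_pencil (K : realType) (n : nat) (E A : 'M[K]_n) : Prop :=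
  \det ('X *: map_mx polyC E - map_mx polyC A) != 0.

(* For the empty matrix ([n = 0]) the nilpotency index is [0], since there
   [N ^+ 0 = 1 = 0]; hence a pencil with invertible [E] has index [0] below. *)
Definition nilpotency_index (K : realType) (n : nat) (N : 'M[K]_n)
    (nu : nat) : Prop :=
  N ^+ nu = 0 /\ forall k : nat, (k < nu)%N -> N ^+ k != 0.

(* [nu] is the Kronecker index of the regular pencil [lambda E - A]: in a
   (quasi-)Weierstrass form  W (lambda E - A) T = lambda diag(1, N) - diag(S, 1)
   with [W], [T] invertible, the nilpotent block [N] has nilpotency index
   [nu]. *)
Definition kronecker_index (K : realType) (n : nat) (E A : 'M[K]_n)
    (nu : nat) : Prop :=
  regular_pencil E A /\
  exists (d a : nat) (eq_n : (d + a)%N = n)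
         (W T : 'M[K]_n) (S : 'M[K]_d) (N : 'M[K]_a),
    [/\ W \in unitmx, T \in unitmx,
        W *m E *m T = castmx (eq_n, eq_n) (block_mx 1%:M 0 0 N),
        W *m A *m T = castmx (eq_n, eq_n) (block_mx S 0 0 1%:M)
      & nilpotency_index N nu].

(* The DAE  E x' = (J - R) x + B u(t). *)
Record phDAE (K : realType) (n m : nat) := PhDAE {
  dae_E : 'M[K]_n;
  dae_J : 'M[K]_n;
  dae_R : 'M[K]_n;
  dae_B : 'M[K]_(n, m)
}.

Definition dae_index (K : realType) (n m : nat) (D : phDAE K n m)
    (nu : nat) : Prop :=
  kronecker_index (dae_E D) (dae_J D - dae_R D) nu.

(* The algebraic equations of the DAE are obtained by multiplying it from the
   left by [KE^T], where [KE] is a projector onto [ker E]. *)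
Definition only_differential (K : realType) (n p : nat) (KE : 'M[K]_n)
    (M : 'M[K]_(n, p)) : Prop :=
  KE^T *m M = 0.

Definition jr_version_a (K : realType) (n m : nat) (KE : 'M[K]_n)
    (D : phDAE K n m) : Prop :=
  only_differential KE (dae_R D) /\ only_differential KE (dae_B D).

Definition jr_version_b (K : realType) (n m : nat) (KE : 'M[K]_n)
    (D : phDAE K n m) : Prop :=
  only_differential KE (dae_J D).

Inductive element : Type :=
  Capacitance | Inductance | Resistance | CurrentSource | VoltageSource.

(* The nodes are ['I_(num_nodes.+1)]; the node [ord0] is the grounded one.
   Parallel branches are allowed, and [num_branches k] may be [0]. *)
Record network := Network {
  num_nodes : nat;
  num_branches : element -> nat;
  tail : forall k : element, 'I_(num_branches k) -> 'I_num_nodes.+1;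
  head : forall k : element, 'I_(num_branches k) -> 'I_num_nodes.+1
}.

Definition adjacent (net : network) : rel 'I_(num_nodes net).+1 :=
  fun u v =>
    has (fun k => [exists b : 'I_(num_branches net k),
                     ((tail b == u) && (head b == v)) ||
                     ((tail b == v) && (head b == u))])
        [:: Capacitance; Inductance; Resistance; CurrentSource; VoltageSource].

Definition connected_network (net : network) : Prop :=
  forall u v : 'I_(num_nodes net).+1, connect (@adjacent net) u v.

(* The [k]-block of the reduced incidence matrix. Row [i] belongs to the
   non-ground node [lift ord0 i]; the entry is 1 if the branch leaves that node
   and -1 if it enters it. *)
Definition incidence (K : realType) (net : network) (k : element)
    : 'M[K]_(num_nodes net, num_branches net k) :=
  \matrix_(i, b) ((tail b == lift ord0 i)%:R - (head b == lift ord0 i)%:R).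

(* The state (e, i_L, i_V) has dimension [n + (n_L + n_V)] and the input
   (i_S, v_S) has dimension [n_I + n_V]; the last two block rows and columns of
   the system matrices are grouped together. *)

Definition mna_dim (net : network) : nat :=
  (num_nodes net +
    (num_branches net Inductance + num_branches net VoltageSource))%N.

Definition mna_input_dim (net : network) : nat :=
  (num_branches net CurrentSource + num_branches net VoltageSource)%N.

Definition mna_E (K : realType) (net : network)
    (C : 'M[K]_(num_branches net Capacitance))
    (L : 'M[K]_(num_branches net Inductance)) : 'M[K]_(mna_dim net) :=
  let A_C := incidence K net Capacitance in
  block_mx (A_C *m C *m A_C^T) 0
           0                   (block_mx L 0
                                         0 0).

Definition mna_J (K : realType) (net : network) : 'M[K]_(mna_dim net) :=
  let A_L := incidence K net Inductance in
  let A_V := incidence K net VoltageSource in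
  block_mx 0                    (row_mx (- A_L) (- A_V))
           (col_mx A_L^T A_V^T) 0.

Definition mna_R (K : realType) (net : network)
    (G : 'M[K]_(num_branches net Resistance)) : 'M[K]_(mna_dim net) :=
  let A_G := incidence K net Resistance in
  block_mx (A_G *m G *m A_G^T) 0
           0                   0.

Definition mna_B (K : realType) (net : network)
    : 'M[K]_(mna_dim net, mna_input_dim net) :=
  let A_I := incidence K net CurrentSource in
  block_mx (- A_I) 0
           0       (col_mx 0 (- 1%:M)).

Definition mna_dae (K : realType) (net : network)
    (C : 'M[K]_(num_branches net Capacitance))
    (L : 'M[K]_(num_branches net Inductance))
    (G : 'M[K]_(num_branches net Resistance))
    : phDAE K (mna_dim net) (mna_input_dim net) :=
  PhDAE (mna_E C L) (mna_J K net) (mna_R G) (mna_B K net).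

Definition mna_KE (K : realType) (net : network)
    (K_C : 'M[K]_(num_nodes net)) : 'M[K]_(mna_dim net) :=
  block_mx K_C 0
           0   (block_mx (0 : 'M_(num_branches net Inductance)) 0
                         0 1%:M).

(* Main.v *)
Require Import Defs.
From HB Require Import structures.
From mathcomp Require Import all_boot all_order all_algebra.
From mathcomp Require Import reals.

(** An index-1 pencil lambda E - A has a singular leading matrix E, and no
    nonzero vector of ker E is mapped by A into the image of E
    ([index1_singular], [index1_tractable]); both are read off the Weierstrass
    form, whose nilpotent block is zero but not empty. The lemma confronts this
    with the block structure of the MNA matrices.

    With a voltage source, the block row of the source equations decides.  It
    consists of algebraic equations and carries the block -I of B, so version
    (a) fails ([not_only_differential_mna_B]).  Version (b)
    would force A_V = 0; the source equations would then not involve the state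
    at all, and the pencil would have a zero row, against regularity
    ([not_jr_version_b]).

    Without voltage sources, version (a) makes R vanish on ker E, since R is
    symmetric.  So for v in ker A_C^T the vector x = (v, 0) satisfies E x = 0
    and (J - R) x = (0, A_L^T v), which lies in the image of E because L is
    invertible. Index 1 gives v = 0, that is, A_C^T is injective. As C and L are
    positive definite, E is then invertible and the index is 0, not 1
    ([not_jr_version_a_without_sources]). *)

Set Implicit Arguments.
Unset Strict Implicit.
Unset Printing Implicit Defensive.

Import Order.TTheory GRing.Theory Num.Theory.
Local Open Scope ring_scope.

Lemma injective_unitmx (F : fieldType) (n : nat) (M : 'M[F]_n) :
  (forall v : 'cV[F]_n, M *m v = 0 -> v = 0) -> M \in unitmx.
Proof.
move=> injM; rewrite -unitmx_tr -row_free_unit -kermx_eq0.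
apply/eqP/row_matrixP => i; rewrite row0; apply: trmx_inj; rewrite trmx0.
by apply: injM; apply: trmx_inj; rewrite trmx_mul trmxK trmx0 -row_mul mulmx_ker row0.
Qed.

Lemma spd_mx_congr_ker (K : realType) (m n : nat) (A : 'M[K]_(m, n))
    (M : 'M[K]_n) (v : 'cV[K]_m) :
  spd_mx M -> A *m M *m A^T *m v = 0 -> A^T *m v = 0.
Proof.
move=> [_ posM]; rewrite -!mulmxA => AMAv0; apply/eqP/negP => /negP/posM.
by rewrite trmx_mul trmxK -!mulmxA AMAv0 mulmx0 mxE ltxx.
Qed.

Lemma spd_mx_unit (K : realType) (n : nat) (M : 'M[K]_n) :
  spd_mx M -> M \in unitmx.
Proof.
move=> spdM; apply: injective_unitmx => v Mv0.
have := @spd_mx_congr_ker _ _ _ 1%:M M v spdM.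
by rewrite trmx1 mul1mx mulmx1 mul1mx; apply.
Qed.

(** * Index-1 pencils *)

Lemma zero_row_not_regular (K : realType) (n : nat) (E A : 'M[K]_n) (i : 'I_n) :
  row i E = 0 -> row i A = 0 -> ~ regular_pencil E A.
Proof.
move=> /rowP E0 /rowP A0 /eqP; apply; rewrite (expand_det_row _ i).
apply: big1 => j _; move: (E0 j) (A0 j); rewrite !mxE => -> ->.
by rewrite polyC0 mulr0 subr0 mul0r.
Qed.

(** The zero nilpotent block has positive size, as its power 0 is nonzero; it
    therefore contributes zero columns to the Weierstrass form of E. *)
Lemma index1_singular (K : realType) (n : nat) (E A : 'M[K]_n) :
  kronecker_index E A 1 -> E \notin unitmx.
Proof.
case=> _ [d [a [eq_n [W [T [S [N [uW uT eqE _ [N1 N0]]]]]]]]].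
subst n; rewrite castmx_id in eqE; rewrite expr1 in N1; subst N.
apply/negP => uE; have uWET : W *m E *m T \in unitmx by rewrite !unitmx_mul uW uE.
have /eqP := N0 0%N isT; rewrite expr0; apply.
have := mulKmx uWET (col_mx 0 1%:M : 'M_(d + a, a)).
rewrite {2}eqE mul_block_col !mul0mx mulmx0 !addr0 col_mx0 mulmx0.
by rewrite -col_mx0 => /eq_col_mx[].
Qed.

(** In Weierstrass coordinates a vector of ker E has only components in the
    nilpotent part, where A acts as the identity and the image of E is zero. *)
Lemma index1_tractable (K : realType) (n : nat) (E A : 'M[K]_n)
    (x y : 'cV[K]_n) :
  kronecker_index E A 1 -> E *m x = 0 -> A *m x = E *m y -> x = 0.
Proof.
case=> _ [d [a [eq_n [W [T [S [N [uW uT eqE eqA [N1 _]]]]]]]]].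
subst n; rewrite !castmx_id in eqE eqA; rewrite expr1 in N1; subst N.
rewrite -(mulKVmx uT x) -(mulKVmx uT y).
move: (invmx T *m x) (invmx T *m y) => x' y' Ex0 Ax.
suff -> : x' = 0 by rewrite mulmx0.
have := congr1 (mulmx W) Ex0; have := congr1 (mulmx W) Ax.
rewrite mulmx0 !mulmxA eqE eqA -(vsubmxK x') -(vsubmxK y') !mul_block_col.
rewrite !mul0mx !mul1mx !addr0 !add0r => /eq_col_mx[_ ->].
by rewrite -[RHS]col_mx0 => /eq_col_mx[-> _]; rewrite col_mx0.
Qed.

(** * The MNA matrices *)

Section MNA.

Variables (K : realType) (net : network).
Variables (C : 'M[K]_(num_branches net Capacitance)).
Variables (L : 'M[K]_(num_branches net Inductance)).
Variables (G : 'M[K]_(num_branches net Resistance)).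
Variable K_C : 'M[K]_(num_nodes net).

Let A_C := incidence K net Capacitance.
Let A_L := incidence K net Inductance.

Lemma mna_E_unit :
  spd_mx C -> spd_mx L -> num_branches net VoltageSource = 0%N ->
  (forall v : 'cV[K]_(num_nodes net), A_C^T *m v = 0 -> v = 0) ->
  mna_E C L \in unitmx.
Proof.
move=> hC hL nV0 injC; apply: injective_unitmx => x.
rewrite -(vsubmxK x) -(vsubmxK (dsubmx x)) /mna_E !mul_block_col !mul0mx.
rewrite !addr0 !add0r -[RHS]col_mx0 => /eq_col_mx[ACv0].
rewrite -[RHS]col_mx0 => /eq_col_mx[Li0 _].
rewrite (injC _ (spd_mx_congr_ker hC ACv0)).
rewrite -(mulKmx (spd_mx_unit hL) (usubmx (dsubmx x))) Li0 mulmx0.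
suff -> : dsubmx (dsubmx x) = 0 by rewrite !col_mx0.
by apply/matrixP => -[j ltj]; exfalso; rewrite nV0 in ltj.
Qed.

(** The voltage source block of K_E^T B is that of B, namely -I. *)
Lemma not_only_differential_mna_B :
  (0 < num_branches net VoltageSource)%N ->
  ~ only_differential (mna_KE K_C) (mna_B K net).
Proof.
move=> nV_gt0; rewrite /only_differential /mna_KE /mna_B.
rewrite !tr_block_mx !trmx0 trmx1 mulmx_block mul_block_col.
rewrite !mul0mx !add0r mul1mx -[RHS]block_mx0 => /eq_block_mx[_ _ _].
rewrite -[RHS]col_mx0 => /eq_col_mx[_].
move=> /matrixP/(_ (Ordinal nV_gt0) (Ordinal nV_gt0)).
by rewrite !mxE eqxx => /eqP; rewrite oppr_eq0 oner_eq0.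
Qed.

(** The source equations are themselves algebraic equations, so K_E^T copies
    them unchanged. *)
Lemma row_source_mul_KE (p : nat) (M : 'M[K]_(mna_dim net, p))
    (j : 'I_(num_branches net VoltageSource)) :
  row (rshift _ (rshift _ j)) ((mna_KE K_C)^T *m M) = row (rshift _ (rshift _ j)) M.
Proof.
rewrite -[M in LHS]vsubmxK -(vsubmxK (dsubmx M)) /mna_KE !tr_block_mx.
rewrite !trmx0 trmx1 !mul_block_col !mul0mx !add0r mul1mx !rowKd.
by rewrite !row_dsubmx.
Qed.

(** Under version (b), every source equation is a zero row of the pencil. *)
Lemma not_jr_version_b :
  regular_pencil (mna_E C L) (mna_J K net - mna_R G) ->
  (0 < num_branches net VoltageSource)%N ->
  ~ jr_version_b (mna_KE K_C) (mna_dae C L G).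
Proof.
move=> reg nV_gt0 KEJ0; move: reg.
pose i : 'I_(mna_dim net) := rshift _ (rshift _ (Ordinal nV_gt0)).
apply: (@zero_row_not_regular _ _ _ _ i).
  by rewrite /mna_E /block_mx !rowKd row_row_mx row0 rowKd row_row_mx !row0 !row_mx0.
rewrite linearB /= -[row i (mna_J K net)]row_source_mul_KE.
rewrite [X in row _ X]KEJ0 row0 sub0r.
by rewrite /mna_R /block_mx rowKd row_row_mx !row0 row_mx0 oppr0.
Qed.

Lemma not_jr_version_a_without_sources :
  spd_mx C -> spd_mx L -> spd_mx G ->
  dae_index (mna_dae C L G) 1 -> projector_onto_ker K_C A_C^T ->
  num_branches net VoltageSource = 0%N ->
  ~ jr_version_a (mna_KE K_C) (mna_dae C L G).
Proof.
move=> hC hL [symG _] index1 [_ imK_C] nV0 [KER0 _].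
apply/negP: (index1_singular index1); rewrite negbK /=.
apply: mna_E_unit => // v ACv0; have [w def_v] := (imK_C v).2 ACv0.
have RKC0 : incidence K net Resistance *m G *m (incidence K net Resistance)^T *m K_C = 0.
  apply: trmx_inj; rewrite trmx0 !trmx_mul trmxK symG mulmxA.
  move: KER0; rewrite /only_differential /mna_KE /= /mna_R tr_block_mx !trmx0.
  rewrite mulmx_block !mulmx0 !mul0mx !addr0 -[RHS]block_mx0 => /eq_block_mx[H _ _ _].
  by rewrite -!mulmxA in H *.
pose x : 'cV[K]_(mna_dim net) := col_mx v 0.
pose y : 'cV[K]_(mna_dim net) := col_mx 0 (col_mx (invmx L *m (A_L^T *m v)) 0).
have Ex0 : mna_E C L *m x = 0.
  by rewrite /mna_E /x mul_block_col -!mulmxA ACv0 !mulmx0 !mul0mx !addr0 col_mx0.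
have Ax : (mna_J K net - mna_R G) *m x = mna_E C L *m y.
  rewrite mulmxBl /mna_J /mna_R /mna_E /x /y !mul_block_col !mulmx0 !mul0mx.
  rewrite !addr0 !add0r mulKVmx ?spd_mx_unit // mul_col_mx.
  rewrite [in X in - X]def_v (mulmxA _ K_C) RKC0 mul0mx col_mx0 subr0.
  (* The source rows of both sides are empty. *)
  congr (col_mx _ (col_mx _ _)).
  by apply/matrixP => -[j ltj]; exfalso; rewrite nV0 in ltj.
by have := index1_tractable index1 Ex0 Ax; rewrite /x -[RHS]col_mx0 => /eq_col_mx[].
Qed.

End MNA.

Theorem lemma1 (K : realType) (net : network)
    (C : 'M[K]_(num_branches net Capacitance))
    (L : 'M[K]_(num_branches net Inductance))
    (G : 'M[K]_(num_branches net Resistance))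
    (K_C : 'M[K]_(num_nodes net))
    (hconn : connected_network net)
    (hC : spd_mx C) (hL : spd_mx L) (hG : spd_mx G)
    (hindex : dae_index (mna_dae C L G) 1)
    (hK_C : projector_onto_ker K_C (incidence K net Capacitance)^T) :
  ~ jr_version_a (mna_KE K_C) (mna_dae C L G) /\
  ((0 < num_branches net VoltageSource)%N ->
     ~ jr_version_a (mna_KE K_C) (mna_dae C L G) /\
     ~ jr_version_b (mna_KE K_C) (mna_dae C L G)).
Proof.
have not_a : ~ jr_version_a (mna_KE K_C) (mna_dae C L G).
  case: (posnP (num_branches net VoltageSource)) => [nV0 | nV_gt0].
    exact: not_jr_version_a_without_sources.
  by case=> _; apply: not_only_differential_mna_B.
split=> // nV_gt0; split=> //.
by apply: not_jr_version_b => //; case: hindex.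
Qed.
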